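(* Let $V=\{0,1,2,\dots\}$, $k_b(x,y)=\sum_{j=0}^{\min(x,y)}\binom{x}{j}\binom{y}{j}$ on $V\times V$, and let $\mathscr{H}=\mathscr{H}(k_b)$ be its reproducing kernel Hilbert space. For a positive integer $n$ let $F_n=\{0,1,\dots,n\}$, let $K_n=(k_b(x,y))_{(x,y)\in F_n\times F_n}$ and let $L_n$ be the $(n+1)\times(n+1)$ lower triangular matrix with entries $(L_n)_{xy}=\binom{x}{y}$ for $0\le y\le x\le n$ and $(L_n)_{xy}=0$ for $x<y$. Then: (i) $K_n$ is invertible, with $K_n^{-1}=(L_n^{tr})^{-1}(L_n)^{-1}$. (ii) For every $x\in F_n$ the diagonal entry of $K_n^{-1}$ is $$\langle x,K_n^{-1}x\rangle_{l^2}=\sum_{k=x}^{n}\binom{k}{x}^2.$$ Consequently, for all $x_1\in F_n$, $$\left\Vert P_{F_n}(\delta_{x_1})\right\Vert_{\mathscr{H}}^2=\sum_{k=x_1}^{n}\binom{k}{x_1}^2=1+\binom{x_1+1}{x_1}^2+\binom{x_1+2}{x_1}^2+\cdots+\binom{n}{x_1}^2,$$ and therefore $\Vert\delta_{x_1}\Vert_{\mathscr{H}}^2=\sum_{k=x_1}^\infty\binom{k}{x_1}^2=\infty$ for every $x_1\in V$; in other words, no $\delta_x$ ($x\in V$) belongs to $\mathscr{H}$.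
   Context: $\mathscr{H}(k_b)$ is the Hilbert space of functions on $V$ obtained by completing $\mathrm{span}\{k_x:x\in V\}$, $k_x=k_b(\cdot,x)$, with $\langle k_x,k_y\rangle_{\mathscr{H}}=k_b(x,y)$. $\delta_x$ is the function on $V$ equal to $1$ at $x$ and $0$ elsewhere. $\langle x,K_n^{-1}x\rangle_{l^2}$ denotes the $(x,x)$ entry of $K_n^{-1}$, and $tr$ denotes transpose. $P_{F_n}(\delta_{x_1}):=\sum_{y\in F_n}(K_n^{-1}\delta_{x_1})(y)\,k_y\in\mathscr{H}$ (this formula is used even though $\delta_{x_1}$ need not be in $\mathscr{H}$). $\|\delta_{x_1}\|_{\mathscr{H}}^2$ is understood as $\sup_n\|P_{F_n}(\delta_{x_1})\|^2_{\mathscr{H}}$, with the value $\infty$ meaning $\delta_{x_1}\notin\mathscr{H}$. *)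

(* Defs.v *)
From HB Require Import structures.
From mathcomp Require Import all_boot all_order all_algebra.
From mathcomp Require Import sesquilinear.
From mathcomp Require Import all_classical all_reals all_analysis.
From mathcomp Require Import ring lra zify.
Set Implicit Arguments.
Unset Strict Implicit.
Unset Printing Implicit Defensive.
Import Order.TTheory GRing.Theory Num.Theory.
Import numFieldNormedType.Exports.
Local Open Scope classical_set_scope.
Local Open Scope ring_scope.

(* A (real) reproducing kernel Hilbert space of k: the completion of the span  *)
(* of the sections k_x = k(., x) (rkhs_dense, completeness of the carrier),    *)
(* realized as a space of functions on T by the injection rkhs_fun. Since      *)
(* rkhs_fun (k_y) x = k x y, rkhs_reproducing contains <k_y, k_x> = k x y; it  *)
(* determines the space up to a unique isometry compatible with rkhs_fun.      *)
Record rkhs (R : realType) (T : Type) (k : T -> T -> R) := Rkhs {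
  rkhs_space :> completeNormedModType R ;
  rkhs_inner : {dot rkhs_space for idfun} ;
  rkhs_innerE : forall f : rkhs_space, rkhs_inner f f = `|f| ^+ 2 ;
  rkhs_fun : {linear rkhs_space -> (T -> R)} ;
  rkhs_fun_inj : injective rkhs_fun ;
  rkhs_sec : T -> rkhs_space ;
  rkhs_secE : forall x, rkhs_fun (rkhs_sec x) = k^~ x ;
  rkhs_reproducing : forall (f : rkhs_space) x,
    rkhs_fun f x = rkhs_inner f (rkhs_sec x) ;
  rkhs_dense : dense [set f : rkhs_space | exists s : seq (R * T),
    f = \sum_(p <- s) p.1 *: rkhs_sec p.2]
}.
Arguments rkhs_fun {R T k} _.
Arguments rkhs_sec {R T k} _ _.
Arguments rkhs_inner {R T k} _.

Lemma rkhs_inner_sec (R : realType) (T : Type) (k : T -> T -> R) (H : rkhs k)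
  x y : rkhs_inner H (rkhs_sec H x) (rkhs_sec H y) = k y x.
Proof. by rewrite -rkhs_reproducing rkhs_secE. Qed.

Definition delta_fun (R : realType) (x : nat) : nat -> R := fun y => (y == x)%:R.

Definition gram_mx (R : realType) (k : nat -> nat -> R) n : 'M[R]_n.+1 :=
  \matrix_(x, y) k x y.

(* P_{F_n} g, where F_n = {0, ..., n}; only the values of g on F_n are used,   *)
(* so g need not be the function of an element of H.                           *)
Definition rkhs_proj (R : realType) (k : nat -> nat -> R) (H : rkhs k) n
    (g : nat -> R) : H :=
  \sum_(y < n.+1)
    (invmx (gram_mx k n) *m \col_(z < n.+1) g z) y 0 *: rkhs_sec H y.

(* The possibly infinite squared norm sup_n |P_{F_n} delta_x|^2, over the      *)
(* n > 0 with x in F_n.                                                        *)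
Definition delta_sqnorm (R : realType) (k : nat -> nat -> R) (H : rkhs k)
    (x : nat) : \bar R :=
  ereal_sup [set (`|rkhs_proj H n (delta_fun R x)| ^+ 2)%:E
            | n in [set n | (0 < n)%N && (x <= n)%N]].

Definition binom_kernel (R : realType) (x y : nat) : R :=
  \sum_(j < (minn x y).+1) 'C(x, j)%:R * 'C(y, j)%:R.

Definition binom_mx (R : realType) n : 'M[R]_n.+1 :=
  \matrix_(x, y) if (y <= x)%N then 'C(x, y)%:R else 0.

(* Existence of the space attached to binom_kernel, as the sequence space l^2  *)
(* with c representing x |-> \sum_(j <= x) c_j 'C(x, j).                       *)
Definition l2_pred (R : realType) : {pred nat -> R} :=
  [pred c : nat -> R | `[< cvgn (series (fun j => c j ^+ 2)) >]].

Lemma cvg_seriesM (R : realType) (c d : nat -> R) :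
  cvgn (series (fun j => c j ^+ 2)) -> cvgn (series (fun j => d j ^+ 2)) ->
  cvgn (series (fun j => c j * d j)).
Proof.
move=> hc hd; apply: normed_cvg.
apply: (@series_le_cvg _ _ (fun j => c j ^+ 2 + d j ^+ 2)) => //.
- by move=> n; rewrite /= normr_ge0.
- by move=> n; rewrite addr_ge0 ?sqr_ge0.
- move=> n; rewrite /= normrM -(real_normK (num_real (c n))).
  rewrite -(real_normK (num_real (d n))).
  have := sqr_ge0 (`|c n| - `|d n|); have := normr_ge0 (c n).
  have := normr_ge0 (d n); nra.
- exact: is_cvg_seriesD hc hd.
Qed.

Lemma l2_submod (R : realType) : subsemimod_closed (@l2_pred R).
Proof.
split; first split.
- apply/asboolP/cvg_ex; exists 0.
  rewrite (_ : series _ = fun=> 0); first exact: cvg_cst.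
  by apply/funext => n; rewrite /series /= big1 // => i _; rewrite [X in X ^+ 2](_ : _ = 0) ?expr0n.
- move=> c d /asboolP hc /asboolP hd; apply/asboolP.
  rewrite (_ : (fun j => _) = ((fun j => c j ^+ 2) + (fun j => d j ^+ 2)) +
     2%:R *: (fun j => c j * d j)).
    apply: is_cvg_seriesD; first exact: is_cvg_seriesD.
    by apply: is_cvg_seriesZ; exact: cvg_seriesM.
  by apply/funext => j; rewrite !fctE /= /GRing.scale /=; ring.
- move=> a c /asboolP hc; apply/asboolP.
  rewrite (_ : (fun j => _) = (a ^+ 2) *: (fun j => c j ^+ 2)).
    exact: is_cvg_seriesZ.
  by apply/funext => j; rewrite !fctE exprMn.
Qed.

HB.instance Definition _ (R : realType) :=
  GRing.isSubSemiModClosed.Build R (nat -> R) (@l2_pred R) (@l2_submod R).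

Record l2 (R : realType) := L2 { l2_val :> nat -> R; _ : l2_val \in @l2_pred R }.
HB.instance Definition _ (R : realType) := [isSub for @l2_val R].
HB.instance Definition _ (R : realType) := [Choice of l2 R by <:].
HB.instance Definition _ (R : realType) := [SubChoice_isSubLmodule of l2 R by <:].

Section l2_inner.
Variable R : realType.
Implicit Types (c d : l2 R) (a : R).

Definition l2_inner c d : R := limn (series (fun j => c j * d j)).

Lemma l2_sqr_cvg c : cvgn (series (fun j => c j ^+ 2)).
Proof. by case: c => c /= /asboolP. Qed.

Lemma l2_inner_cvg c d : cvgn (series (fun j => c j * d j)).
Proof. by apply: cvg_seriesM; exact: l2_sqr_cvg. Qed.

Lemma l2_innerC c d : l2_inner c d = l2_inner d c.
Proof. by congr (limn (series _)); apply/funext => j; rewrite mulrC. Qed.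

Lemma l2_innerP a c c' d :
  l2_inner (a *: c + c') d = a * l2_inner c d + l2_inner c' d.
Proof.
have h : cvgn (series (a *: (fun j => c j * d j))).
  by apply: is_cvg_seriesZ; exact: l2_inner_cvg.
have -> : a * l2_inner c d = limn (series (a *: (fun j => c j * d j))).
  by rewrite (lim_seriesZ a (@l2_inner_cvg c d)).
rewrite /l2_inner -(lim_seriesD h (@l2_inner_cvg c' d)).
by congr (limn (series _)); apply/funext => j; rewrite /= mulrDl -mulrA.
Qed.

Lemma l2_sum_le c n : \sum_(0 <= j < n) c j ^+ 2 <= l2_inner c c.
Proof.
have -> : l2_inner c c = limn (series (fun j => c j ^+ 2)) by [].
apply: (nondecreasing_cvgn_le _ (@l2_sqr_cvg c)).
by apply/nondecreasing_seqP => m; rewrite seriesSr lerDl sqr_ge0.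
Qed.

Lemma l2_coord_le c j : c j ^+ 2 <= l2_inner c c.
Proof.
apply: le_trans (l2_sum_le c j.+1); rewrite big_nat_recr //= lerDr.
by apply: sumr_ge0 => i _; exact: sqr_ge0.
Qed.

Lemma l2_inner_ge0 c : 0 <= l2_inner c c.
Proof. by apply: le_trans (l2_coord_le c 0); exact: sqr_ge0. Qed.

Lemma l2_inner_gt0 c : c != 0 -> 0 < l2_inner c c.
Proof.
move=> c0; rewrite lt_neqAle l2_inner_ge0 andbT eq_sym.
apply: contra_neq c0 => cc0; apply/val_inj/funext => j /=.
by apply/eqP; rewrite -sqrf_eq0 eq_le sqr_ge0 -cc0 l2_coord_le.
Qed.

Lemma l2_le c (M : R) :
  (forall n, \sum_(0 <= j < n) c j ^+ 2 <= M) -> l2_inner c c <= M.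
Proof.
move=> cM; apply: limr_le; first exact: l2_inner_cvg.
by near=> n; exact: cM.
Unshelve. all: by end_near. Qed.

Lemma l2_bounded (c : nat -> R) (M : R) :
  (forall n, \sum_(0 <= j < n) c j ^+ 2 <= M) -> c \in @l2_pred R.
Proof.
move=> cM; apply/asboolP; apply: nondecreasing_is_cvgn.
  by apply/nondecreasing_seqP => m; rewrite seriesSr lerDl sqr_ge0.
by exists M => _ [n _ <-]; exact: cM.
Qed.

Lemma l2_innerl d : linear_for *%R (l2_inner^~ d).
Proof. by move=> a c c'; exact: l2_innerP. Qed.

Lemma l2_innerr c : linear_for (idfun \; *%R) (l2_inner c).
Proof. by move=> a d d'; rewrite l2_innerC l2_innerP !(l2_innerC c). Qed.

HB.instance Definition _ :=
  bilinear_isBilinear.Build R (l2 R) (l2 R) R *%R (idfun \; *%R) l2_inner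
    (l2_innerl, l2_innerr).

Fact l2_inner_herm c d : l2_inner c d = (-1) ^+ false * idfun (l2_inner d c).
Proof. by rewrite expr0 mul1r l2_innerC. Qed.

HB.instance Definition _ := isHermitianSesquilinear.Build R (l2 R) false idfun
  l2_inner l2_inner_herm.
HB.instance Definition _ := isDotProduct.Build R (l2 R) l2_inner l2_inner_gt0.

Definition l2_dot : {dot l2 R for idfun} := l2_inner.

Lemma l2_inner0l d : l2_inner 0 d = 0.
Proof. by have := l2_innerP (-1) d d d; rewrite scaleN1r addNr mulN1r addNr. Qed.

Lemma l2_innerDl c c' d : l2_inner (c + c') d = l2_inner c d + l2_inner c' d.
Proof. by have := l2_innerP 1 c c' d; rewrite scale1r mul1r. Qed.

Lemma l2_innerZl a c d : l2_inner (a *: c) d = a * l2_inner c d.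
Proof. by have := l2_innerP a c 0 d; rewrite l2_inner0l !addr0. Qed.

Lemma l2_innerD c d : l2_inner (c + d) (c + d) =
  l2_inner c c + l2_inner c d *+ 2 + l2_inner d d.
Proof.
rewrite l2_innerDl l2_innerC l2_innerDl (l2_innerC d (c + d)) l2_innerDl.
rewrite (l2_innerC d c); ring.
Qed.

Lemma l2_innerZ a c : l2_inner (a *: c) (a *: c) = a ^+ 2 * l2_inner c c.
Proof. by rewrite l2_innerZl l2_innerC l2_innerZl mulrA. Qed.

Lemma l2_CS c d : l2_inner c d ^+ 2 <= l2_inner c c * l2_inner d d.
Proof.
have [->|d0] := eqVneq d 0.
  by rewrite l2_innerC !l2_inner0l mulr0 expr0n.
have dp := l2_inner_gt0 d0.
have := l2_inner_ge0 (l2_inner d d *: c + (- l2_inner c d) *: d).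
rewrite l2_innerD !l2_innerZ l2_innerZl l2_innerC l2_innerZl (l2_innerC d c).
move=> h; rewrite -(ler_pM2l dp) -subr_ge0.
by rewrite [leRHS](_ : _ = l2_inner d d ^+ 2 * l2_inner c c + l2_inner d d *
  (- l2_inner c d * l2_inner c d) *+ 2 + (- l2_inner c d) ^+ 2 * l2_inner d d) //; ring.
Qed.

Definition l2_norm c : R := Num.sqrt (l2_inner c c).

Lemma l2_normE c : l2_norm c ^+ 2 = l2_inner c c.
Proof. by rewrite sqr_sqrtr // l2_inner_ge0. Qed.

Fact l2_normD c d : l2_norm (c + d) <= l2_norm c + l2_norm d.
Proof.
rewrite -(ler_pXn2r (n := 2)) ?nnegrE ?addr_ge0 ?sqrtr_ge0 //.
rewrite l2_normE l2_innerD sqrrD !l2_normE lerD2r lerD2l lerMn2r /=.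
rewrite -sqrtrM ?l2_inner_ge0 //; apply: le_trans (ler_norm _) _.
by rewrite -sqrtr_sqr ler_wsqrtr // l2_CS.
Qed.

Fact l2_normZ a c : l2_norm (a *: c) = `|a| * l2_norm c.
Proof. by rewrite /l2_norm l2_innerZ sqrtrM ?sqr_ge0 // sqrtr_sqr. Qed.

Fact l2_norm0_eq0 c : l2_norm c = 0 -> c = 0.
Proof.
move=> c0; apply/eqP; apply: contra_eqT c0 => /l2_inner_gt0.
by rewrite -sqrtr_gt0 lt0r => /andP[].
Qed.

HB.instance Definition _ :=
  Lmodule_isNormed.Build R (l2 R) l2_normD l2_normZ l2_norm0_eq0.

Lemma l2_normrE c : l2_inner c c = `|c| ^+ 2.
Proof. by rewrite -l2_normE. Qed.

Lemma l2_complete (F : set_system (l2 R)) : ProperFilter F -> cauchy F -> cvg F.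
Proof.
move=> FF Fc.
have Fc2 e : 0 < e -> \forall f & g \near F, `|f - g| < e.
  by move=> e0; have /cauchy_ballP := Fc; move=> /(_ e e0);
  rewrite near_map2; apply: filterS => p; rewrite -ball_normE.
have coordC j : cauchy ((fun c : l2 R => c j) @ F).
  apply/cauchy_ballP => e e0; rewrite near_map2.
  have := Fc2 e e0; apply: filterS => -[f g] /= fg.
  rewrite -ball_normE /=; apply: le_lt_trans fg.
  by rewrite -(ler_pXn2r (n := 2)) ?nnegrE // -l2_normrE real_normK ?num_real //
    (l2_coord_le (f - g) j).
pose a j := lim ((fun c : l2 R => c j) @ F).
have acvg j : (fun c : l2 R => c j) @ F --> a j by apply: R_complete.
have key e : 0 < e -> F [set f : l2 R | forall n,
    \sum_(0 <= j < n) (f j - a j) ^+ 2 <= e ^+ 2].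
  move=> e0; apply: (filterS _ (nearP_dep (Fc2 e e0))) => f Hf n.
  have : (fun g : l2 R => \sum_(0 <= j < n) (f j - g j) ^+ 2) @ F -->
      \sum_(0 <= j < n) (f j - a j) ^+ 2.
    apply: (@cvg_big _ _ _ _ _ _ _ _ _ (fun j (g : l2 R) => (f j - g j) ^+ 2)) => [|j _]; first by move=> x; exact: add_continuous.
    have h : (fun g : l2 R => f j - g j) @ F --> f j - a j.
      by apply: cvgB; [exact: cvg_cst|exact: acvg].
    exact: (cvgM h h).
  move=> H; rewrite -(cvg_lim _ H) //.
  apply: limr_le; first by apply/cvg_ex; eexists; exact: H.
  move: Hf; apply: filterS => g fg.
  apply: le_trans (l2_sum_le (f - g) n) _.
  by rewrite l2_normrE ler_pXn2r ?nnegrE ?(ltW fg) ?(ltW e0).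
have /filter_ex[f1 hf1] := key 1 ltr01.
have aP : a \in @l2_pred R.
  have -> : a = val (f1 - L2 (l2_bounded hf1)).
    by apply/funext => j /=; rewrite !fctE /= opprB addrC subrK.
  exact: valP.
apply/cvg_ex; exists (L2 aP); apply/cvgrPdist_le => e e0.
have := key e e0; apply: filterS => f Hf.
rewrite distrC -(ler_pXn2r (n := 2)) ?nnegrE ?(ltW e0) //. rewrite -l2_normrE.
exact: l2_le.
Qed.

HB.instance Definition _ := Uniform_isComplete.Build (l2 R) l2_complete.

End l2_inner.


Section binom_rkhs.
Variable R : realType.
Local Notation k := (binom_kernel R).

Lemma fin_series_cvg (u : nat -> R) m : (forall j, (m <= j)%N -> u j = 0) ->
  series u @ \oo --> series u m.
Proof.
move=> um; apply: cvg_near_cst; exists m => // n /= mn; apply/eqP.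
rewrite /series /= (big_cat_nat _ mn) //= [X in _ + X]big_nat_cond.
by rewrite [X in _ + X]big1 ?addr0 // => j /andP[/andP[/um]].
Qed.

Lemma fin_l2 (c : nat -> R) m : (forall j, (m <= j)%N -> c j = 0) ->
  c \in @l2_pred R.
Proof.
move=> cm; apply/asboolP/cvg_ex.
exists (series (fun j => c j ^+ 2) m); apply: fin_series_cvg => j mj.
by rewrite cm // expr0n.
Qed.

Lemma l2_inner_fin (c d : l2 R) m : (forall j, (m <= j)%N -> d j = 0) ->
  l2_inner c d = \sum_(0 <= j < m) c j * d j.
Proof.
move=> dm; apply: cvg_lim => //; apply: fin_series_cvg => j mj.
by rewrite dm ?mulr0.
Qed.

Fact binom_sec_subproof x j : (x.+1 <= j)%N -> ('C(x, j))%:R = 0 :> R.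
Proof. by move=> xj; rewrite bin_small. Qed.
Definition binom_sec x : l2 R := L2 (fin_l2 (@binom_sec_subproof x)).

Definition binom_ev (c : l2 R) : nat -> R :=
  fun x => \sum_(0 <= j < x.+1) c j * ('C(x, j))%:R.

Fact binom_ev_linear : linear binom_ev.
Proof.
move=> a c d; apply/funext => x; rewrite /binom_ev /= [RHS]/GRing.add /=.
rewrite [X in _ = X + _]/GRing.scale /= scaler_sumr -big_split /=.
by apply: eq_bigr => j _; rewrite mulrDl -mulrA.
Qed.
HB.instance Definition _ :=
  GRing.isLinear.Build R (l2 R) (nat -> R) *:%R binom_ev binom_ev_linear.

Lemma binom_evE c x : binom_ev c x = l2_inner c (binom_sec x).
Proof. by rewrite (@l2_inner_fin _ _ x.+1) // => j; exact: binom_sec_subproof. Qed.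

Lemma binom_ev_inj : injective binom_ev.
Proof.
move=> c d cd; apply/val_inj/funext; elim/ltn_ind => x IH /=.
have := congr1 (fun f => f x) cd; rewrite /binom_ev !big_nat_recr //= binn !mulr1.
rewrite (eq_big_nat _ _ (F2 := fun j => d j * ('C(x, j))%:R)).
  by move/addrI.
by move=> j /andP[_ /IH /= ->].
Qed.

Lemma binom_ev_sec x : binom_ev (binom_sec x) = k^~ x.
Proof.
apply/funext => y; rewrite /binom_ev /binom_kernel -[RHS](big_mkord xpredT (fun j => ('C(y, j))%:R * ('C(x, j))%:R)) /=.
rewrite (@big_cat_nat _ _ _ (minn y x).+1) ?ltnS ?geq_minl //=.
rewrite [X in _ + X]big_nat_cond [X in _ + X]big1 ?addr0; last first.
  move=> j /andP[/andP[xj jy] _]; rewrite bin_small ?mul0r //; lia.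
by apply: eq_bigr => j _; rewrite mulrC.
Qed.

Let spans (f : l2 R) :=
  exists s : seq (R * nat), f = \sum_(p <- s) p.1 *: binom_sec p.2.

Let spansD f g : spans f -> spans g -> spans (f + g).
Proof. by move=> [s ->] [t ->]; exists (s ++ t); rewrite big_cat. Qed.

Let spansZ a f : spans f -> spans (a *: f).
Proof.
move=> [s ->]; exists [seq (a * p.1, p.2) | p <- s].
by rewrite big_map scaler_sumr; apply: eq_bigr => p _; rewrite scalerA.
Qed.

Let spans_sum m (F : nat -> l2 R) : (forall j, (j < m)%N -> spans (F j)) ->
  spans (\sum_(0 <= j < m) F j).
Proof.
elim: m => [_|m IH Fs]; first by rewrite big_geq //; exists [::]; rewrite big_nil.
rewrite big_nat_recr //=; apply: spansD; last exact: Fs.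
by apply: IH => j jm; apply: Fs; exact: ltnW.
Qed.

Fact unit_l2_subproof i j : (i.+1 <= j)%N -> delta_fun R i j = 0.
Proof. by rewrite /delta_fun => ij; rewrite gtn_eqF. Qed.
Let e_ i : l2 R := L2 (fin_l2 (@unit_l2_subproof i)).

Let l2_sumE m (F : nat -> l2 R) i :
  (\sum_(0 <= j < m) F j) i = \sum_(0 <= j < m) F j i.
Proof. by elim/big_rec2: _ => // j y1 y2 _ <-. Qed.

Let spans_e i : spans (e_ i).
Proof.
elim/ltn_ind: i => i IH.
have -> : e_ i = binom_sec i + (-1) *: \sum_(0 <= j < i) ('C(i, j))%:R *: e_ j.
  apply/val_inj/funext => l /=.
  change (delta_fun R i l = ('C(i, l))%:R + -1 *
    (\sum_(0 <= j < i) ('C(i, j))%:R *: e_ j) l); rewrite l2_sumE /=.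
  rewrite (eq_bigr (fun j => if j == l then ('C(i, l))%:R else 0)); last first.
    move=> j _; rewrite /= [LHS]/(_ * _) /delta_fun.
    by have [->|_] := eqVneq j l; [exact: mulr1|exact: mulr0].
  rewrite -big_mkcond /= big_mkord /delta_fun.
  have [li|il] := ltnP l i.
    rewrite (big_pred1 (Ordinal li)) => [|j]; last by rewrite /= -val_eqE.
    by rewrite mulN1r subrr ltn_eqF.
  rewrite big_pred0 ?mulr0 ?addr0 => [|j]; last by rewrite ltn_eqF // (leq_trans _ il).
  by have [->|ne] := eqVneq l i; rewrite ?binn // bin_small // ltn_neqAle eq_sym ne.
apply: spansD; first by exists [:: (1, i)]; rewrite big_seq1 scale1r.
by apply/spansZ/spans_sum => j ji; apply/spansZ/IH.
Qed.

Let trunc (c : l2 R) m : l2 R := \sum_(0 <= j < m) c j *: e_ j.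

Let truncE c m i : trunc c m i = if (i < m)%N then c i else 0.
Proof.
rewrite /trunc l2_sumE (eq_bigr (fun j => if j == i then c i else 0)).
  rewrite -big_mkcond /= big_mkord; case: ltnP => im.
    by rewrite (big_pred1 (Ordinal im)) // => j; rewrite /= -val_eqE.
  by rewrite big_pred0 // => j; rewrite ltn_eqF // (leq_trans _ im).
move=> j _; rewrite [LHS]/(_ * _) /= /delta_fun.
by have [->|_] := eqVneq j i; [exact: mulr1|exact: mulr0].
Qed.

Lemma binom_dense : dense [set f : l2 R | exists s : seq (R * nat),
    f = \sum_(p <- s) p.1 *: binom_sec p.2].
Proof.
move=> U [c Uc] Uo.
have tr0 m j : (m <= j)%N -> trunc c m j = 0 by move=> mj; rewrite truncE ltnNge mj.
have h m : `|c - trunc c m| ^+ 2 = l2_inner c c - \sum_(0 <= j < m) c j ^+ 2.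
  rewrite -l2_normrE -scaleN1r l2_innerD l2_innerZ l2_innerC l2_innerZl.
  rewrite (l2_innerC (trunc c m) c) !(l2_inner_fin _ (tr0 m)).
  rewrite [X in -1 * X](_ : _ = \sum_(0 <= j < m) c j ^+ 2); last first.
    by apply: eq_big_nat => j /andP[_ jm]; rewrite truncE jm.
  rewrite [X in (-1) ^+ 2 * X](_ : _ = \sum_(0 <= j < m) c j ^+ 2); last first.
    by apply: eq_big_nat => j /andP[_ jm]; rewrite truncE jm.
  by ring.
have trc : trunc c @ \oo --> c.
  apply/cvgrPdist_lt => e e0.
  have /cvgrPdist_lt/(_ (e ^+ 2)) := @l2_sqr_cvg R c.
  rewrite exprn_gt0 // => /(_ isT); apply: filterS => m.
  rewrite -[limn _]/(l2_inner c c) -[series _ m]/(\sum_(0 <= j < m) c j ^+ 2) -h.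
  by rewrite ger0_norm ?exprn_ge0 // ltr_pXn2r ?nnegrE // ltW.
have /filter_ex[m Um] : \forall m \near \oo, U (trunc c m).
  by apply: trc; exact: open_nbhs_nbhs.
exists (trunc c m); split => //.
by apply: spans_sum => j _; apply/spansZ/spans_e.
Qed.

Definition binom_rkhs : rkhs k := @Rkhs _ _ k (l2 R) (@l2_dot R) (@l2_normrE R)
  binom_ev binom_ev_inj binom_sec binom_ev_sec binom_evE binom_dense.

End binom_rkhs.

(* Main.v *)
Require Import Defs.
From HB Require Import structures.
From mathcomp Require Import all_boot all_order all_algebra.
From mathcomp Require Import sesquilinear.
From mathcomp Require Import all_classical all_reals all_analysis.
Set Implicit Arguments.
Unset Strict Implicit.
Unset Printing Implicit Defensive.
Import Order.TTheory GRing.Theory Num.Theory.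
Import numFieldNormedType.Exports.
Local Open Scope classical_set_scope.
Local Open Scope ring_scope.

(** The Gram matrix factors as [K = L L^T], because row [x] of [L] lists the
coordinates ['C(x, j)] of [k_x] in an orthonormal system. Row [x] of [L] also
lists the coefficients of [(1 + X)^x], so that [L^-1] expresses the powers of
['X] in those of [X - 1]: its entries are [(-1)^(x - y) 'C(x, y)]
(lemma [invmx_binom_mx]). Hence [K^-1 = L^-T L^-1], and the diagonal entries of
[K^-1] are the sums of the squares of the columns of [L^-1].

In any reproducing kernel Hilbert space whose Gram matrix on [F_n] is
invertible, [P_{F_n} g] takes the values of [g] on [F_n] ([rkhs_proj_fun]); for
an [f] in the space it is thus the orthogonal projection of [f] onto the span
of the [k_y], [y] in [F_n], and [|P_{F_n} f| <= |f|] ([rkhs_proj_le]). For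
[g = delta_x] the squared norm [|P_{F_n} g|^2] is the entry [(x, x)] of [K^-1].
All its terms ['C(k, x)^2] with [x <= k <= n] are at least [1], so these norms
are unbounded in [n]; both the supremum and the series are infinite, and
[delta_x] cannot be the function of an element of the space. *)

Section projection.
Variables (R : realType) (k : nat -> nat -> R) (H : rkhs k) (n : nat).
Implicit Types (g : nat -> R) (f : H).

Local Notation coef g := (invmx (gram_mx k n) *m \col_(z < n.+1) g z).

Lemma rkhs_inner_proj f g :
  rkhs_inner H f (rkhs_proj H n g) = \sum_(y < n.+1) coef g y 0 * rkhs_fun H f y.
Proof.
rewrite /rkhs_proj linear_sumr; apply: eq_bigr => y _.
by rewrite linearZr_LR /= rkhs_reproducing.
Qed.

Hypothesis Kunit : gram_mx k n \in unitmx.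

(** [P_{F_n} g] interpolates [g] on [F_n]. *)
Lemma rkhs_proj_fun g (z : 'I_n.+1) : rkhs_fun H (rkhs_proj H n g) z = g z.
Proof.
have := mulKVmx Kunit (\col_(i < n.+1) g i).
move=> /matrixP/(_ z 0); rewrite !mxE => <-.
rewrite /rkhs_proj linear_sum fct_sumE; apply: eq_bigr => y _.
by rewrite linearZ /= rkhs_secE [gram_mx k n z y]mxE mulrC.
Qed.

Lemma sqr_norm_rkhs_proj g :
  `|rkhs_proj H n g| ^+ 2 = \sum_(y < n.+1) coef g y 0 * g y.
Proof.
rewrite -rkhs_innerE rkhs_inner_proj.
by apply: eq_bigr => y _; rewrite rkhs_proj_fun.
Qed.

Lemma sqr_norm_rkhs_proj_delta (x : 'I_n.+1) :
  `|rkhs_proj H n (delta_fun R x)| ^+ 2 = invmx (gram_mx k n) x x.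
Proof.
rewrite sqr_norm_rkhs_proj (bigD1 x) //= big1 ?addr0 => [|y yx]; last first.
  by rewrite {2}/delta_fun (negbTE yx : (_ == _ :> nat) = _) mulr0.
rewrite {2}/delta_fun eqxx mulr1 mxE (bigD1 x) //= big1 ?addr0 => [|y yx].
  by rewrite mxE /delta_fun eqxx mulr1.
by rewrite mxE /delta_fun (negbTE yx : (_ == _ :> nat) = _) mulr0.
Qed.

(** Bessel's inequality: by interpolation [f - P_{F_n} f] vanishes on [F_n],
hence is orthogonal to every [k_y] with [y] in [F_n]. *)
Lemma rkhs_proj_le f : `|rkhs_proj H n (rkhs_fun H f)| ^+ 2 <= `|f| ^+ 2.
Proof.
set p := rkhs_proj H n _.
have fp0 : rkhs_inner H (f - p) p = 0.
  rewrite rkhs_inner_proj big1 // => y _.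
  have -> : rkhs_fun H (f - p) y = 0.
    by rewrite linearB /= !fctE rkhs_proj_fun subrr.
  by rewrite mulr0.
have := hnormDd fp0 : rkhs_inner H (f - p + p) (f - p + p) =
  rkhs_inner H (f - p) (f - p) + rkhs_inner H p p.
by rewrite subrK !rkhs_innerE => ->; rewrite lerDr sqr_ge0.
Qed.

End projection.

(** For [j < i] the exponent truncates to [0] but the binomial vanishes. *)
Lemma coef_exp_subX1 (R : comNzRingType) j i :
  (('X - 1 : {poly R}) ^+ j)`_i = (-1) ^+ (j - i) * 'C(j, i)%:R.
Proof.
rewrite addrC exprDn coef_sum.
rewrite (eq_bigr (fun l : 'I_j.+1 =>
  if l == i :> nat then (-1) ^+ (j - i) * 'C(j, i)%:R else 0)); last first.
  move=> l _; rewrite coefMn -(rmorphN1 polyC) -rmorphXn coefCM coefXn eq_sym.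
  case: eqP => [->|_]; first by rewrite mulr1 mulr_natr.
  by rewrite mulr0 mul0rn.
have [ij|ji] := ltnP i j.+1.
  by rewrite -big_mkcond (big_pred1 (Ordinal ij)).
by rewrite big1 ?bin_small ?mulr0 // => l _; rewrite ltn_eqF // (leq_trans _ ji).
Qed.

(** Binomial inversion: the coefficient of ['X^i] in the expansion of ['X^m]
in powers of [X - 1]. *)
Lemma binom_inversion (R : comNzRingType) m i :
  \sum_(j < m.+1) 'C(m, j)%:R * ((-1) ^+ (j - i) * 'C(j, i)%:R) = (m == i)%:R :> R.
Proof.
rewrite eq_sym -coefXn -[in RHS](subrK 1 'X) addrC exprDn coef_sum.
apply: eq_bigr => j _.
by rewrite expr1n mul1r coefMn coef_exp_subX1 mulr_natl.
Qed.

Section binom_matrix.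
Variables (R : realType) (n : nat).
Local Notation L := (binom_mx R n).
Local Notation K := (gram_mx (binom_kernel R) n).

Lemma binom_mxE x y : L x y = 'C(x, y)%:R.
Proof. by rewrite mxE; case: leqP => // xy; rewrite bin_small. Qed.

Lemma gram_binom_kernel : K = L *m L^T.
Proof.
apply/matrixP => x y; rewrite !mxE /binom_kernel.
have xn : (minn x y < n.+1)%N by rewrite gtn_min ltn_ord.
rewrite (big_ord_widen _ (fun j => 'C(x, j)%:R * 'C(y, j)%:R) xn) big_mkcond.
apply: eq_bigr => j _; rewrite [L^T _ _]mxE !binom_mxE ltnS leq_min.
case: (leqP j x) => [_|xj]; last by rewrite bin_small ?mul0r.
by case: (leqP j y) => [//|yj]; rewrite (bin_small yj) mulr0.
Qed.

Local Notation M :=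
  (\matrix_(x, y) ((-1) ^+ (x - y) * 'C(x, y)%:R) : 'M[R]_n.+1).

Let mulmx_binom_mx : L *m M = 1%:M.
Proof.
apply/matrixP => x y; rewrite !mxE -val_eqE /= -binom_inversion.
rewrite (big_ord_widen _ (fun j =>
  'C(x, j)%:R * ((-1) ^+ (j - y) * 'C(j, y)%:R)) (ltn_ord x)) [in RHS]big_mkcond.
apply: eq_bigr => j _; rewrite binom_mxE mxE ltnS.
by case: leqP => // xj; rewrite bin_small ?mul0r.
Qed.

Lemma binom_mx_unit : L \in unitmx.
Proof. by have [] := mulmx1_unit mulmx_binom_mx. Qed.

Lemma invmx_binom_mx : invmx L = M.
Proof. by rewrite -[LHS]mulmx1 -mulmx_binom_mx mulKmx // binom_mx_unit. Qed.

Lemma gram_binom_unit : K \in unitmx.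
Proof. by rewrite gram_binom_kernel unitmx_mul unitmx_tr binom_mx_unit. Qed.

Lemma invmx_gram_binom : invmx K = invmx L^T *m invmx L.
Proof.
have LT : L^T \in unitmx by rewrite unitmx_tr binom_mx_unit.
have h : invmx L^T *m invmx L *m K = 1%:M.
  by rewrite gram_binom_kernel mulmxA mulmxKV ?binom_mx_unit // mulVmx.
by rewrite -[RHS]mulmx1 -(mulmxV gram_binom_unit) mulmxA h mul1mx.
Qed.

Lemma invmx_gram_binom_diag (x : 'I_n.+1) :
  invmx K x x = \sum_(x <= l < n.+1) 'C(l, x)%:R ^+ 2.
Proof.
rewrite invmx_gram_binom -trmx_inv mxE invmx_binom_mx.
rewrite (eq_bigr (fun l : 'I_n.+1 => 'C(l, x)%:R ^+ 2)); last first.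
  by move=> l _; rewrite !mxE -expr2 exprMn sqrr_sign mul1r.
rewrite -(big_mkord xpredT (fun l => 'C(l, x)%:R ^+ 2)).
rewrite (big_cat_nat (leq0n x)) ?(ltnW (ltn_ord x)) //= big_nat big1 ?add0r //.
by move=> l /andP[_ lx]; rewrite bin_small // expr0n.
Qed.

End binom_matrix.

Lemma sum_sqr_bin_ge (R : realType) (x m : nat) : (x <= m)%N ->
  (m - x)%:R <= \sum_(x <= l < m) 'C(l, x)%:R ^+ 2 :> R.
Proof.
move=> xm; rewrite -[X in X%:R <= _]muln1 -sum_nat_const_nat natr_sum !big_nat.
apply: ler_sum => l /andP[xl _].
by rewrite -natrX ler_nat sqrn_gt0 bin_gt0.
Qed.

Lemma sum_sqr_bin_unbounded (R : realType) (x : nat) (A : R) :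
  exists n, [/\ (0 < n)%N, (x <= n)%N &
    A <= \sum_(x <= l < n.+1) 'C(l, x)%:R ^+ 2].
Proof.
(* The sum up to [x + m + 1] has [m + 2] terms, all at least [1]. *)
have [m Am] : exists m, A <= m%:R.
  by exists (Num.bound `|A|); apply: le_trans (ler_norm A) (ltW (archi_boundP _)).
exists (x + m).+1; split=> //; first by rewrite leqW ?leq_addr.
apply: le_trans Am (le_trans _ (sum_sqr_bin_ge _ _)).
  by rewrite ler_nat -addnS -addnS addKn !leqW.
by rewrite !leqW ?leq_addr.
Qed.

Theorem corollary3p20 (R : realType) (H : rkhs (binom_kernel R)) :
  (forall n : nat, (0 < n)%N ->
    let K := gram_mx (binom_kernel R) n in
    let L := binom_mx R n in
    [/\ K \in unitmx /\ L \in unitmx,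
        invmx K = invmx L^T *m invmx L,
        (forall x : 'I_n.+1,
          invmx K x x = \sum_(x <= k < n.+1) 'C(k, x)%:R ^+ 2)
      & (forall x1 : 'I_n.+1,
          `|rkhs_proj H n (delta_fun R x1)| ^+ 2
            = \sum_(x1 <= k < n.+1) 'C(k, x1)%:R ^+ 2 /\
          \sum_(x1 <= k < n.+1) 'C(k, x1)%:R ^+ 2
            = 1 + \sum_(x1.+1 <= k < n.+1) 'C(k, x1)%:R ^+ 2 :> R)]) /\
  (forall x1 : nat,
    [/\ delta_sqnorm H x1 = (\sum_(x1 <= k <oo) ('C(k, x1)%:R ^+ 2)%:E)%E,
        (\sum_(x1 <= k <oo) ('C(k, x1)%:R ^+ 2 : R)%:E = +oo)%E
      & ~ range (rkhs_fun H) (delta_fun R x1)]).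
Proof.
have projE n (x : 'I_n.+1) : `|rkhs_proj H n (delta_fun R x)| ^+ 2 =
    \sum_(x <= k < n.+1) 'C(k, x)%:R ^+ 2.
  by rewrite sqr_norm_rkhs_proj_delta ?gram_binom_unit // invmx_gram_binom_diag.
split=> [n _ K L|x].
  split.
  - by split; [exact: gram_binom_unit|exact: binom_mx_unit].
  - exact: invmx_gram_binom.
  - exact: invmx_gram_binom_diag.
  - by move=> x; split; [exact: projE|rewrite big_ltn // binn expr1n].
have series_oo : (\sum_(x <= k <oo) ('C(k, x)%:R ^+ 2 : R)%:E = +oo)%E.
  apply: eq_infty => A; have [n [_ _ An]] := sum_sqr_bin_unbounded x A.
  apply: le_trans (nneseries_lim_ge n.+1 _); first by rewrite sumEFin lee_fin.
  by move=> k _ _; rewrite lee_fin sqr_ge0.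
split=> //.
  rewrite series_oo; apply: eq_infty => A.
  have [n [n0 xn An]] := sum_sqr_bin_unbounded x A.
  apply: le_trans (ereal_sup_ubound _); last by exists n; [rewrite /= n0|reflexivity].
  by rewrite lee_fin (projE n (Ordinal (xn : (x < n.+1)%N))).
(* On such an [f] the bound [|P_{F_n} f|^2 <= |f|^2] fails for large [n]. *)
case=> f _ fx; have [n [_ xn]] := sum_sqr_bin_unbounded x (`|f| ^+ 2 + 1).
rewrite -(projE n (Ordinal (xn : (x < n.+1)%N))) /= -fx.
by rewrite leNgt ltr_pwDr // rkhs_proj_le ?gram_binom_unit.
Qed.
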